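(* Let $V$ be a real Hilbert space with topological dual $V'$ and duality pairing $\langle\cdot,\cdot\rangle$, let $K\subset V$ be closed, convex and non-empty, and let $a:V\times V\to\mathbb{R}$ be a symmetric, continuous bilinear form which is coercive with constant $m>0$, i.e. $m\|v\|_V^2\le a(v,v)$ for all $v\in V$. Let $g_1,g_2\in V'$ and let $u_1=u_{g_1}$, $u_2=u_{g_2}$ be the solutions of the variational inequality $u\in K$, $a(u,v-u)\ge\langle g,v-u\rangle$ for all $v\in K$, with $g=g_1$ and $g=g_2$ respectively. For $\mu\in[0,1]$ put $u_3(\mu)=\mu u_1+(1-\mu)u_2$, $g_3(\mu)=\mu g_1+(1-\mu)g_2$, $u_4(\mu)=u_{g_3(\mu)}$, and $$\alpha=a(u_1,u_2-u_1)-\langle g_1,u_2-u_1\rangle,\qquad \beta=a(u_2,u_1-u_2)-\langle g_2,u_1-u_2\rangle.$$ Then $$m\|u_4(\mu)-u_3(\mu)\|_V^2+\mu I_{14}(\mu)+(1-\mu)I_{24}(\mu)\le\mu(1-\mu)(\alpha+\beta)\qquad\forall\mu\in[0,1],$$ where $$I_{14}(\mu)=a(u_1,u_4(\mu)-u_1)-\langle g_1,u_4(\mu)-u_1\rangle\ge 0,$$ $$I_{24}(\mu)=a(u_2,u_4(\mu)-u_2)-\langle g_2,u_4(\mu)-u_2\rangle\ge 0.$$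
   Context: For every $g\in V'$ the variational inequality ''$u\in K$ and $a(u,v-u)\ge\langle g,v-u\rangle$ for all $v\in K$'' has a unique solution, denoted $u_g$. *)

(* Defs.v *)
From HB Require Import structures.
From mathcomp Require Import all_boot all_order all_algebra.
From mathcomp Require Import all_classical all_reals all_analysis.
From mathcomp Require Import ring lra.

Set Implicit Arguments.
Unset Strict Implicit.
Unset Printing Implicit Defensive.

Import Order.TTheory GRing.Theory Num.Theory.
Import numFieldNormedType.Exports.

Local Open Scope classical_set_scope.
Local Open Scope ring_scope.

HB.mixin Record isHilbert (R : realType) V of CompleteNormedModule R V := {
  inner : V -> V -> R ;
  inner_bilinear : bilinear_for *%R *%R inner ;
  innerC : forall u v, inner u v = inner v u ;
  inner_norm : forall v, inner v v = `|v| ^+ 2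
}.

#[short(type="hilbertType")]
HB.structure Definition Hilbert (R : realType) :=
  {V of CompleteNormedModule R V & isHilbert R V}.

(* The codomain is R^o so that V -> R^o is an R-module: the combination
   mu *: g1 + (1 - mu) *: g2 is then taken pointwise.  The duality pairing
   <g, v> is application g v. *)
Definition topological_dual (R : realType) (V : normedModType R) :
    set (V -> R^o) :=
  [set g | linear g /\ continuous g].

Section VariationalInequality.
Variables (R : realType) (V : hilbertType R).
Variables (a : {biscalar V}) (K : set V).
Implicit Types (g : V -> R^o) (u v w : V).

Definition solves_VI g u : Prop :=
  K u /\ forall v, K v -> a u (v - u) >= g (v - u).

(* solution operator g |-> u_g; see VI_solutionP *)
Definition VI_solution g : V := get [set u | solves_VI g u].

Section WellPosedness.
Variables (m : R).
Hypotheses (K_closed : closed K).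
Hypotheses (K_convex : convex_set (K : set (convex_lmodType V))).
Hypotheses (K_neq0 : K !=set0).
Hypotheses (a_sym : forall u v, a u v = a v u).
Hypotheses (a_cont : continuous (fun p : V * V => a p.1 p.2)).
Hypotheses (m_gt0 : 0 < m).
Hypotheses (a_coercive : forall v, m * `|v| ^+ 2 <= a v v).

Lemma VI_unique g u v : topological_dual g ->
  solves_VI g u -> solves_VI g v -> u = v.
Proof.
move=> [glin _] [Ku hu] [Kv hv].
pose gl : {linear V -> R^o} := HB.pack g (GRing.isLinear.Build _ _ _ _ g glin).
have gN : g (u - v) = - g (v - u) by rewrite -(linearN gl) opprB.
have := hu v Kv; have := hv u Ku; rewrite gN.
rewrite !(linearBr a) => h1 h2.
have := a_coercive (u - v); rewrite (linearBl a) !(linearBr a) => h.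
have h0 : m * `|u - v| ^+ 2 <= 0 by apply: le_trans h _; lra.
rewrite pmulr_rle0// in h0.
have : `|u - v| ^+ 2 == 0 by rewrite eq_le h0 sqr_ge0.
by rewrite sqrf_eq0 normr_eq0 subr_eq0 => /eqP.
Qed.

Lemma K_segment u v (t : R) : 0 <= t -> t <= 1 -> K u -> K v ->
  K (u + t *: (v - u)).
Proof.
move=> t0 t1 Ku Kv.
have := K_convex (Itv01 t0 t1) (mem_set Kv) (mem_set Ku).
move=> /set_mem; congr K.
by rewrite /conv/= /unstable.onem scalerBr scalerBl scale1r addrCA.
Qed.

Let J g v := a v v - 2 * g v.

Lemma VI_exists g : topological_dual g -> exists u, solves_VI g u.
Proof.
move=> [glin gcont].
pose gl : {linear V -> R^o} := HB.pack g (GRing.isLinear.Build _ _ _ _ g glin).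
have gD x y : g (x + y) = g x + g y by exact: (linearD gl).
have gZ t x : g (t *: x) = t * g x by exact: (linearZ_LR gl).
have aD u w t : a (u + t *: w) (u + t *: w) =
    a u u + 2 * t * a u w + t ^+ 2 * a w w.
  rewrite (linearDl a) !(linearDr a) !(linearZl_LR a) !(linearZr_LR a).
  by rewrite (a_sym w u); ring.
have Jt u w t : J g (u + t *: w) =
    J g u + 2 * t * (a u w - g w) + t ^+ 2 * a w w.
  by rewrite /J aD gD gZ; ring.
have [c c0 gb] : exists2 c, 0 <= c & forall v, `|g v| <= c * `|v|.
  have /linear_boundedP [y [yreal fr]] :=
    @continuous_linear_bounded _ _ _ 0 gl (gcont 0).
  exists (Num.max 0 (y + 1)); first by rewrite le_max lexx.
  by move=> v; apply: fr; rewrite lt_max ltrDl ltr01 orbT.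
have Jlb v : - (c ^+ 2 / m) <= J g v.
  have h1 : g v <= c * `|v| by apply: le_trans (gb v); rewrite ler_norm.
  have h2 : 0 <= m * (`|v| - c / m) ^+ 2 by rewrite mulr_ge0 ?sqr_ge0 ?ltW.
  have h3 : m * (`|v| - c / m) ^+ 2 = m * `|v| ^+ 2 - 2 * (c * `|v|) + c ^+ 2 / m.
    by field; rewrite gt_eqF.
  by have := a_coercive v; rewrite /J; lra.
pose d := inf (J g @` K).
have [k0 Kk0] := K_neq0.
have hinf : has_inf (J g @` K).
  split; first by exists (J g k0), k0.
  by exists (- (c ^+ 2 / m)) => _ [v _ <-].
have dle v : K v -> d <= J g v.
  by move=> Kv; apply: ge_inf; [exact: hinf.2|exists v].
pose S (e : R) := [set v | K v /\ J g v < d + e].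
have Sne e : 0 < e -> S e !=set0.
  by move=> e0; have [_ [v Kv <-] h] := inf_adherent e0 hinf; exists v.
have Sdist e u v : S e u -> S e v -> m * `|v - u| ^+ 2 <= 4 * e.
  move=> [Ku hu] [Kv hv]; apply: le_trans (a_coercive _) _.
  have hh0 : (0 : R) <= 2^-1 by rewrite invr_ge0.
  have hh1 : (2^-1 : R) <= 1 by rewrite invf_le1// ler1n.
  have := dle _ (K_segment hh0 hh1 Ku Kv); rewrite Jt.
  have := Jt u (v - u) 1; rewrite scale1r addrC subrK.
  have -> : (2^-1 : R) ^+ 2 = 4^-1 by field.
  lra.
pose F := filter_from [set e : R | 0 < e] S.
have FF : ProperFilter F.
  apply: filter_from_proper; last by move=> e; exact: Sne.
  apply: filter_from_filter; first by exists 1 => /=.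
  move=> e1 e2 /= e10 e20; exists (Num.min e1 e2); first by rewrite /= lt_min e10.
  move=> v [Kv hv]; split; split => //; apply: lt_le_trans hv _;
  by rewrite lerD2l ge_min lexx ?orbT.
have Fc : cauchy F.
  apply: cauchy_exP => e e0.
  pose e' := m * e ^+ 2 / 8.
  have e'0 : 0 < e' by rewrite divr_gt0// mulr_gt0// exprn_gt0.
  have [u Su] := Sne _ e'0.
  exists u, e' => // v Sv; rewrite -ball_normE /= distrC.
  rewrite -(@ltr_pXn2r _ 2) ?nnegrE ?normr_ge0// ?(ltW e0)//.
  rewrite -(ltr_pM2l m_gt0); apply: le_lt_trans (Sdist _ _ _ Su Sv) _.
  have := e'0; rewrite /e'; lra.
have /cvg_ex [l Fl] : cvg F by exact: cauchy_cvg.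
have Kl : K l.
  apply: (@closed_cvg _ _ F _ id K K_closed _ l Fl).
  by exists 1 => //= v [].
have Jcont : J g @ F --> J g l.
  apply: cvgB.
    have Fll : (fun v : V => (v, v)) @ F --> (l, l) by exact: cvg_pair.
    exact: (cvg_comp _ _ Fll (@a_cont (l, l))).
  apply: cvgMl_tmp.
  exact: (cvg_comp _ _ Fl (gcont l)).
have Jl v : K v -> J g l <= J g v.
  move=> /dle; apply: le_trans; apply/ler_addgt0Pr => e e0.
  apply: (@closed_cvg _ _ F _ (J g) _ (@closed_le R (d + e)) _ _ Jcont).
  by exists e => //= w [_ /ltW].
exists l; split=> // v Kv.
rewrite -subr_ge0; set b := a l (v - l) - g (v - l).
rewrite leNgt; apply/negP => b0.
pose A := a (v - l) (v - l).
have A0 : 0 <= A.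
  by apply: le_trans (a_coercive _); rewrite mulr_ge0 ?sqr_ge0 ?ltW.
pose t := - b / (A - b).
have Ab : 0 < A - b by lra.
have t0 : 0 < t by rewrite divr_gt0// oppr_gt0.
have t1 : t <= 1 by rewrite ler_pdivrMr//; lra.
have := Jl _ (K_segment (ltW t0) t1 Kl Kv).
rewrite Jt -/b -/A => h.
have h' : 0 <= t * (2 * b + t * A) by move: h; lra.
rewrite pmulr_rge0// in h'.
have tA : t * A <= - b.
  by rewrite /t mulrAC ler_pdivrMr//; nra.
lra.
Qed.

Lemma VI_solutionP g u : topological_dual g ->
  solves_VI g u <-> u = VI_solution g.
Proof.
move=> gd; have sol : solves_VI g (VI_solution g).
  exact: (getPex (VI_exists gd)).
by split=> [hu|->//]; exact: VI_unique gd hu sol.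
Qed.

End WellPosedness.

End VariationalInequality.

(* Main.v *)
(* Testing the inequality for u4 with u3, which lies in K by convexity, and
   using coercivity gives m |u4 - u3|^2 <= g3 (u4 - u3) - a u3 (u4 - u3).
   Adding mu I14 + (1 - mu) I24 cancels every term containing u4; by
   bilinearity what remains is exactly mu (1 - mu) (alpha + beta). *)
From HB Require Import structures.
Require Import Defs.
From mathcomp Require Import all_boot all_order all_algebra.
From mathcomp Require Import all_classical all_reals all_analysis.
From mathcomp Require Import ring lra.

Import Order.TTheory GRing.Theory Num.Theory.
Import numFieldNormedType.Exports.

Local Open Scope classical_set_scope.
Local Open Scope ring_scope.

(** Makes well-posedness applicable to [g3 mu], so that [u4 mu] is a genuine solution. *)
Lemma topological_dual_comb {R : realType} {V : normedModType R}
    {g h : V -> R^o} (s t : R) :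
  topological_dual g -> topological_dual h ->
  topological_dual (s *: g + t *: h).
Proof.
move=> [glin gcont] [hlin hcont]; split.
  by move=> c u v; rewrite !fctE glin hlin /GRing.scale /=; ring.
move=> x; apply: (@cvgD _ R^o _ _ _ (s *: g) (t *: h)).
  by apply: cvgZl_tmp; exact: gcont.
by apply: cvgZl_tmp; exact: hcont.
Qed.

(** Elements of the dual are bare functions with a linearity proof; packing [g] locally as a linear
    map makes the generic lemmas available. *)
Lemma topological_dualB {R : realType} {V : normedModType R}
    {g : V -> R^o} (u v : V) :
  topological_dual g -> g (u - v) = g u - g v.
Proof.
move=> [glin _].
pose gl : {linear V -> R^o} := HB.pack g (GRing.isLinear.Build _ _ _ _ g glin).
exact: (linearB gl).
Qed.

Lemma topological_dual_lin {R : realType} {V : normedModType R}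
    {g : V -> R^o} (u v : V) (s t : R) :
  topological_dual g -> g (s *: u + t *: v) = s * g u + t * g v.
Proof.
move=> [glin _].
pose gl : {linear V -> R^o} := HB.pack g (GRing.isLinear.Build _ _ _ _ g glin).
have gZ : g (t *: v) = t * g v by exact: (linearZ_LR gl).
by rewrite glin gZ.
Qed.

Theorem theorem2p1 (R : realType) (V : hilbertType R)
    (K : set V)
    (K_closed : closed K)
    (K_convex : convex_set (K : set (convex_lmodType V)))
    (K_neq0 : K !=set0)
    (a : {biscalar V})
    (a_sym : forall u v : V, a u v = a v u)
    (a_cont : continuous (fun p : V * V => a p.1 p.2))
    (m : R) (m_gt0 : 0 < m)
    (a_coercive : forall v : V, m * `|v| ^+ 2 <= a v v)
    (g1 g2 : V -> R^o)
    (g1_dual : topological_dual g1) (g2_dual : topological_dual g2) :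
  let u1 := VI_solution a K g1 in
  let u2 := VI_solution a K g2 in
  let u3 (mu : R) := mu *: u1 + (1 - mu) *: u2 in
  let g3 (mu : R) := mu *: g1 + (1 - mu) *: g2 in
  let u4 (mu : R) := VI_solution a K (g3 mu) in
  let alpha := a u1 (u2 - u1) - g1 (u2 - u1) in
  let beta := a u2 (u1 - u2) - g2 (u1 - u2) in
  let I14 (mu : R) := a u1 (u4 mu - u1) - g1 (u4 mu - u1) in
  let I24 (mu : R) := a u2 (u4 mu - u2) - g2 (u4 mu - u2) in
  forall mu : R, 0 <= mu <= 1 ->
    m * `|u4 mu - u3 mu| ^+ 2 + mu * I14 mu + (1 - mu) * I24 mu
      <= mu * (1 - mu) * (alpha + beta)
    /\ 0 <= I14 mu /\ 0 <= I24 mu.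
Proof.
move=> u1 u2 u3 g3 u4 alpha beta I14 I24 mu /andP[mu0 mu1].
(* [VI_solution] is chosen by [get], hence meaningful only once a solution exists: the
   well-posedness hypotheses enter here. *)
have sol g : topological_dual g -> solves_VI a K g (VI_solution a K g).
  move=> gd.
  exact/(VI_solutionP K_closed K_convex K_neq0 a_sym a_cont m_gt0 a_coercive).
have [Ku1 VI1] := sol _ g1_dual.
have [Ku2 VI2] := sol _ g2_dual.
have [Ku4 VI4] := sol _ (topological_dual_comb mu (1 - mu) g1_dual g2_dual).
rewrite -/u1 -/u2 -/(g3 mu) -/(u4 mu) in Ku1 VI1 Ku2 VI2 Ku4 VI4.
(* The two signs come from testing the inequalities for [u1] and [u2] with [u4 mu], which lies in
   [K]. *)
split; last by split; rewrite subr_ge0; [exact: VI1|exact: VI2].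
have Ku3 : K (u3 mu).
  (* The segment starts at [u2]: [u3 mu] is [u2 + mu *: (u1 - u2)]. *)
  have := K_segment K_convex mu0 mu1 Ku2 Ku1; congr K.
  by rewrite /u3 scalerBr scalerBl scale1r addrCA.
have h4 := VI4 _ Ku3.
have hm := a_coercive (u4 mu - u3 mu).
(* Holds by computation: the combination is pointwise and scaling in [R^o] is multiplication. *)
have g3E v : g3 mu v = mu * g1 v + (1 - mu) * g2 v by [].
rewrite !g3E in h4.
rewrite /alpha /beta /I14 /I24.
rewrite !(topological_dualB _ _ g1_dual) in h4 *.
rewrite !(topological_dualB _ _ g2_dual) in h4 *.
rewrite !(linearBr a) in h4 *.
have a4 : a (u4 mu - u3 mu) (u4 mu - u3 mu) =
    a (u4 mu) (u4 mu) - a (u4 mu) (u3 mu)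
    - (a (u3 mu) (u4 mu) - a (u3 mu) (u3 mu)).
  by rewrite (linearBl a) !(linearBr a).
rewrite a4 in hm.
have a3l v : a (u3 mu) v = mu * a u1 v + (1 - mu) * a u2 v.
  by rewrite /u3 (linearDl a) !(linearZl_LR a).
have a3r v : a v (u3 mu) = mu * a v u1 + (1 - mu) * a v u2.
  by rewrite /u3 (linearDr a) !(linearZr_LR a).
have g3u3 g : topological_dual g -> g (u3 mu) = mu * g u1 + (1 - mu) * g u2.
  exact: topological_dual_lin.
rewrite !(g3u3 _ g1_dual) !(g3u3 _ g2_dual) in h4.
rewrite !a3l !a3r in hm h4.
(* With products of [mu] and values of [a], [g1], [g2] taken as monomials, the goal is the sum of
   [hm] and [h4]. Its quadratic part rests on a(u3,u3) - mu a(u1,u1) - (1 - mu) a(u2,u2) = - mu (1 -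
   mu) a(u1 - u2, u1 - u2). *)
lra.
Qed.
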